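(* For every integer $m \geq 1$, there exist infinitely many $\{-1,m\}$-perfect numbers.
   Context: Let $\mathcal{S} \subset \mathbb{Z}$. An integer $n > 1$ with positive divisors $1 = d_0 < d_1 < \cdots < d_r < d_{r+1} = n$ is called $\mathcal{S}$-perfect (of the first kind) if there exist $\lambda_1, \ldots, \lambda_r \in \mathcal{S}$ (not necessarily distinct) such that $1+\sum_{j=1}^{r}\lambda_j d_j = n$. (The divisor $1$ always has coefficient $1$, and every divisor $d$ with $1<d<n$ must receive a coefficient from $\mathcal{S}$.) *)

(* Defs.v *)
From mathcomp Require Export all_boot all_order all_algebra.
From mathcomp Require Export all_classical.

Set Implicit Arguments.
Unset Strict Implicit.
Unset Printing Implicit Defensive.

Import GRing.Theory Num.Theory.

Local Open Scope classical_set_scope.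
Local Open Scope ring_scope.

(* [divisors n] is the increasing list 1 = d_0 < d_1 < ... < d_(r+1) = n, so
   the indices 1, ..., r are exactly those of the divisors strictly between
   1 and n. *)
Definition ndiv_inner (n : nat) : nat := (size (divisors n) - 2)%N.

Definition S_perfect (S : set int) (n : nat) : Prop :=
  (1 < n)%N /\
  exists lambda : nat -> int,
    (forall j : nat, (1 <= j <= ndiv_inner n)%N -> S (lambda j)) /\
    1 + \sum_(1 <= j < (ndiv_inner n).+1)
          lambda j * (nth 0%N (divisors n) j)%:Z = n%:Z.

(* Main.v *)
(* If B is a set of divisors d of n with 1 < d < n, and the coefficient of d is
   m on B and -1 off B, then n is {-1,m}-perfect as soon as
   (m + 1) * sum B = sigma(n) - 2. Put M = m + 1 and n = 2 ^ a * p ^ k with p a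
   prime = 1 mod 2M and u = 2 ^ (a + 1) - 1 coprime to 2M; then
   sigma(n) = u * (1 + p + ... + p ^ k) = u * (k + 1) mod 2M, and k is chosen to
   make this 2. So (sigma(n) - 2) / M is an even number 2s. If 2 ^ a is large
   compared with p, every such s is a sum of distinct proper divisors of n / 2:
   in the list 2 ^ i * p ^ j, ordered by j and then i, each term exceeds the sum
   of the previous ones by at most 1, and n / 2 comes last. Doubling these
   divisors gives B. Infinitely many a are available, namely the multiples of
   totient(M'), with M' the odd part of M. *)
Require Import Defs.
From mathcomp Require Import all_boot all_order all_algebra.
From mathcomp Require Import all_solvable all_field.
From mathcomp Require Import all_classical.
From mathcomp Require Import ring zify.
Import Order.TTheory GRing.Theory Num.Theory.

(** * Primes congruent to 1 modulo N, by cyclotomic polynomials *)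

(** In the product of the ['Phi_e] over [e %| N], the factors with [e %| d] make up ['X^d - 1];
    ['Phi_N] is among the others. *)
Lemma Cyclotomic_Xn_sub_1_dvd {N d : nat} : 0 < N -> d %| N -> d < N ->
  exists q : {poly int}, ('X^N - 1 = 'Phi_N * ('X^d - 1) * q)%R.
Proof.
move=> N_gt0 dvd_dN ltdN.
have d_gt0 : 0 < d by apply: dvdn_gt0 dvd_dN.
rewrite -(prod_Cyclotomic N_gt0) -(prod_Cyclotomic d_gt0).
rewrite (bigID (fun e => e %| d)) /= -big_filter.
have divE : perm_eq [seq e <- divisors N | e %| d] (divisors d).
  apply: uniq_perm; rewrite ?filter_uniq ?divisors_uniq // => e.
  rewrite mem_filter -!dvdn_divisors //.
  by case: (boolP (e %| d)) => // /dvdn_trans ->.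
rewrite (perm_big _ divE) /=.
rewrite -[X in (_ * X)%R]big_filter [X in (_ * X)%R](bigD1_seq N) /=.
- by eexists; rewrite mulrCA mulrA.
- by rewrite mem_filter divisors_id // andbT gtnNdvd.
- by rewrite filter_uniq ?divisors_uniq.
Qed.

(** Differentiate at [x]: each term of the product rule keeps [f] or [g] undifferentiated. *)
Lemma dvdz_double_root {p x : int} {N : nat} {f g h : {poly int}} :
  ('X^N - 1 = f * g * h)%R -> (p %| (f.[x])%R)%Z -> (p %| (g.[x])%R)%Z ->
  (p %| (N%:Z * x ^+ N.-1)%R)%Z.
Proof.
move=> /(congr1 (fun q => (deriv q).[x]%R)) + pf pg.
rewrite derivB derivXn derivC subr0 hornerMn hornerXn -mulr_natl.
rewrite !derivM !hornerE natz => ->.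
have pD (a b : int) : (p %| a)%Z -> (p %| b)%Z -> (p %| (a + b)%R)%Z.
  exact: rpredD.
have pMl (a b : int) : (p %| a)%Z -> (p %| (a * b)%R)%Z by apply: dvdz_mulr.
have pMr (a b : int) : (p %| b)%Z -> (p %| (a * b)%R)%Z by apply: dvdz_mull.
apply: (pD); first by apply: (pMl); apply: (pD); [apply: (pMr) | apply: (pMl)].
by apply: (pMl); apply: (pMl).
Qed.

(** The nonconstant ['Phi_N] takes each of the values 0, 1, -1 only finitely often, hence not at all
    multiples of [N]. *)
Lemma exists_Cyclotomic_gt1 {N : nat} : 0 < N ->
  exists z : nat, 1 < `|(('Phi_N).[(N * z)%N%:Z])%R|%N.
Proof.
move=> N_gt0; set f := 'Phi_N%R.
have f_size : 1 < size f by rewrite size_Cyclotomic ltnS totient_gt0.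
have fB_neq0 c : (f - c%:P != 0)%R.
  rewrite subr_eq0; apply: contraTneq f_size => ->.
  by rewrite size_polyC -leqNgt leq_b1.
pose g := (f * (f - 1%:P) * (f - (-1)%:P))%R.
have g_neq0 : g != 0%R.
  by rewrite !mulf_neq0 // -[f]subr0 -[0%R]/(0%:P)%R.
pose rs := [seq Posz (N * z) | z <- iota 0 (size g)].
have [rs_root|] := boolP (all (root g) rs).
  have := max_poly_roots g_neq0 rs_root.
  rewrite map_inj_uniq ?iota_uniq ?size_map ?size_iota ?ltnn => [/(_ isT)//|].
  by move=> x y [] /eqP; rewrite eqn_pmul2l // => /eqP.
case/allPn => _ /mapP[z _ ->] gz; exists z; move: gz.
rewrite /root !hornerE -/f !mulf_eq0 !negb_or; move: (f.[_])%R => v; lia.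
Qed.

(* Take p dividing 'Phi_N(x) with x a multiple of N. If x had order d < N mod p,
   then x would be a double root of X^N - 1 mod p, hence p would divide N or x,
   while p divides x^N - 1. So N is the order of x and divides p - 1. *)
Lemma exists_prime_modn1 {N : nat} : 0 < N ->
  exists2 p, prime p & p = 1 %[mod N].
Proof.
move=> N_gt0; have [z] := exists_Cyclotomic_gt1 N_gt0.
set x := (N * z)%N => fx_gt1.
pose p := pdiv `|(('Phi_N).[x%:Z])%R|%N.
have p_prime : prime p by apply: pdiv_prime.
have p_fx : (p%:Z %| (('Phi_N).[x%:Z])%R)%Z by rewrite dvdzE pdiv_dvd.
exists p => //.
have p_expE e : (x ^ e == 1 %[mod p]) = (p%:Z %| (x%:Z ^+ e - 1)%R)%Z.
  by rewrite -eqz_mod_dvd -[Posz x]natz -natrX natz -[1%R]/(Posz 1) !modz_nat.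
have xN : x ^ N = 1 %[mod p].
  apply/eqP; rewrite p_expE -hornerXn -[1%R](hornerC _ x%:Z) -hornerN -hornerD.
  rewrite -(prod_Cyclotomic N_gt0) (bigD1_seq N) ?divisors_uniq //=;
    last exact: divisors_id.
  by rewrite hornerM dvdz_mulr.
have p_x : ~~ (p %| x).
  apply/negP => p_x; have := xN; rewrite -(prednK N_gt0) expnS -modnMml.
  by rewrite (eqP p_x) mul0n mod0n modn_small ?prime_gt1.
have x_gt0 : 0 < x by case: (x) p_x; rewrite ?dvdn0.
have xp : x ^ p.-1 = 1 %[mod p].
  rewrite -(totient_prime p_prime); apply: Euler_exp_totient.
  by rewrite coprime_sym prime_coprime.
(* By Bezout, this gcd can stand in for the order of [x] mod [p]. *)
have xd : x ^ gcdn N p.-1 = 1 %[mod p].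
  case: (egcdnP p.-1 N_gt0) => u v uv _.
  have : x ^ (u * N) = x ^ (v * p.-1 + gcdn N p.-1) %[mod p] by rewrite uv.
  rewrite mulnC (mulnC v) expnD !expnM -modnXm xN modnXm exp1n.
  by rewrite -modnMml -(modnXm v) xp modnXm exp1n modnMml mul1n.
have [eqN|neqN] := eqVneq (gcdn N p.-1) N.
  apply/eqP; rewrite eqn_mod_dvd ?prime_gt0 // subn1 -eqN; exact: dvdn_gcdr.
have ltN : gcdn N p.-1 < N by rewrite ltn_neqAle neqN dvdn_leq ?dvdn_gcdl.
have [q XnE] := Cyclotomic_Xn_sub_1_dvd N_gt0 (dvdn_gcdl _ _) ltN.
have /(dvdz_double_root XnE p_fx) :
    (p%:Z %| ((('X^(gcdn N p.-1) - 1) : {poly int}).[x%:Z])%R)%Z.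
  by rewrite !hornerE -p_expE; apply/eqP.
rewrite dvdzE abszM abszX !absz_nat Euclid_dvdM //.
case/orP => [pN|]; first by rewrite dvdn_mulr in p_x.
by rewrite Euclid_dvdX // (negPf p_x).
Qed.

(** * Subset sums of the divisors of 2^a p^k *)

Definition subset_sums_full (L : seq nat) :=
  forall t, t <= sumn L -> exists2 B, subseq B L & sumn B = t.

(** A target above [sumn L] is at least [x]; using [x] leaves a remainder that [L] can reach. *)
Lemma subset_sums_rcons (L : seq nat) (x : nat) :
  subset_sums_full L -> x <= (sumn L).+1 -> subset_sums_full (rcons L x).
Proof.
move=> cL lex t; rewrite sumn_rcons => let_.
have [le_t|gt_t] := leqP t (sumn L).
  have [B sB Bt] := cL _ le_t; exists B => //.
  by apply: subseq_trans sB _; apply: subseq_rcons.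
have [|B sB Bt] := cL (t - x); first lia.
exists (rcons B x); last by rewrite sumn_rcons Bt; lia.
by rewrite -!cats1 cat_subseq.
Qed.

Definition dyadic (a q : nat) := [seq 2 ^ i * q | i <- iota 0 a].

Lemma sumn_dyadic (a q : nat) : sumn (dyadic a q) = (2 ^ a - 1) * q.
Proof.
elim: a => // a IH.
rewrite /dyadic -(addn1 a) iotaD map_cat sumn_cat -/(dyadic a q).
rewrite IH /= add0n addn0 -mulnDl addn1 expnS.
by congr (_ * _); have := expn_gt0 2 a; lia.
Qed.

Lemma subset_sums_dyadic (L : seq nat) (a q : nat) :
  subset_sums_full L -> q <= (sumn L).+1 -> subset_sums_full (L ++ dyadic a q).
Proof.
move=> cL leq; elim: a => [|a IH]; first by rewrite /dyadic cats0.
rewrite /dyadic -(addn1 a) iotaD map_cat catA cats1 -/(dyadic a q).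
apply: subset_sums_rcons => //; rewrite sumn_cat sumn_dyadic add0n.
rewrite mulnBl mul1n; have : q <= 2 ^ a * q by rewrite leq_pmull ?expn_gt0.
lia.
Qed.

(** [a] and [k] count exponents: the largest ones are [a - 1] and [k - 1]. *)
Definition grid (a p k : nat) := flatten [seq dyadic a (p ^ j) | j <- iota 0 k].

Lemma gridS (a p k : nat) : grid a p k.+1 = grid a p k ++ dyadic a (p ^ k).
Proof. by rewrite /grid -(addn1 k) iotaD map_cat flatten_cat /= cats0. Qed.

Lemma sumn_grid (a p k : nat) :
  sumn (grid a p k) = (2 ^ a - 1) * \sum_(j < k) p ^ j.
Proof.
elim: k => [|k IH]; first by rewrite big_ord0 muln0.
by rewrite gridS sumn_cat IH sumn_dyadic big_ord_recr mulnDr.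
Qed.

Lemma expn_le_geom_sum (p k : nat) :
  0 < p -> p ^ k <= (p.-1 * \sum_(j < k) p ^ j).+1.
Proof. by move=> p_gt0; rewrite -predn_exp prednK ?expn_gt0 ?p_gt0. Qed.

(** The geometric sum bounds [p ^ k] with factor [p - 1], which is at most [2 ^ a - 1]. *)
Lemma expn_le_sumn_grid (a p k : nat) : 0 < p <= 2 ^ a ->
  p ^ k <= (sumn (grid a p k)).+1.
Proof.
case/andP=> p_gt0 le_p; apply: leq_trans (expn_le_geom_sum _ k p_gt0) _.
by rewrite sumn_grid ltnS leq_mul2r -subn1 leq_sub2r ?orbT.
Qed.

Lemma subset_sums_grid (a p k : nat) :
  0 < p <= 2 ^ a -> subset_sums_full (grid a p k).
Proof.
move=> p_le; elim: k => [|k IH].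
  by move=> t; rewrite leqn0 => /eqP->; exists [::].
by rewrite gridS; apply: subset_sums_dyadic => //; apply: expn_le_sumn_grid.
Qed.

Lemma perm_grid_divisors (a k : nat) {p : nat} : prime p -> odd p ->
  perm_eq (grid a.+1 p k.+1) (divisors (2 ^ a * p ^ k)).
Proof.
move=> p_prime p_odd; have p_gt0 := prime_gt0 p_prime.
have n_gt0 : 0 < 2 ^ a * p ^ k by rewrite muln_gt0 !expn_gt0 p_gt0.
have memP d : reflect (exists i j, [/\ i <= a, j <= k & d = 2 ^ i * p ^ j])
                      (d \in grid a.+1 p k.+1).
  apply: (iffP flatten_mapP) => [[j]|[i [j [lei lej ->]]]].
    rewrite mem_iota => /andP[_ ltj] /mapP[i].
    rewrite mem_iota => /andP[_ lti] ->.
    by exists i, j.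
  exists j; first by rewrite mem_iota.
  by apply/mapP; exists i; rewrite ?mem_iota.
apply: uniq_perm; rewrite ?divisors_uniq //.
  rewrite /grid /dyadic.
  apply: (allpairs_uniq_dep (f := fun j i => 2 ^ i * p ^ j));
    rewrite ?iota_uniq //.
  move=> /= [j i] [j' i'] _ _ /=.
  (* Entries are distinct: the 2-adic valuation recovers [i], then the power of [p] gives [j]. *)
  have log2p : logn 2 p = 0 by rewrite logn_prime //; case: eqP p_odd => // <-.
  have log2 x y : logn 2 (2 ^ x * p ^ y) = x.
    rewrite lognM ?expn_gt0 ?p_gt0 // !lognX log2p logn_prime //.
    by rewrite muln1 muln0 addn0.
  move=> eq_ij; have eq_i : i = i' by rewrite -(log2 i j) eq_ij log2.
  move: eq_ij; rewrite eq_i => /eqP; rewrite eqn_pmul2l ?expn_gt0 //.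
  by rewrite eqn_exp2l ?prime_gt1 // => /eqP ->.
move=> d; rewrite -dvdn_divisors //; apply/memP/idP.
  move=> [i [j [lei lej ->]]]; apply: dvdn_mul; exact: dvdn_exp2l.
move=> dvd_d; have d_gt0 := dvdn_gt0 n_gt0 dvd_d.
(* Split off [gcdn d (2 ^ a)]; the cofactor [e] is coprime to [f], so by Gauss it divides
   [p ^ k]. *)
have g_gt0 : 0 < gcdn d (2 ^ a) by rewrite gcdn_gt0 d_gt0.
have [i lei gE] : exists2 i, i <= a & gcdn d (2 ^ a) = 2 ^ i.
  by apply/dvdn_pfactor => //; apply: dvdn_gcdr.
have [e dE] := dvdnP (dvdn_gcdl d (2 ^ a)).
have [f aE] := dvdnP (dvdn_gcdr d (2 ^ a)).
have co_ef : coprime e f.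
  rewrite /coprime -(eqn_pmul2r g_gt0) mul1n muln_gcdl -dE -aE; exact: eqxx.
have /dvdn_pfactor[|j lej eE] // : e %| p ^ k.
  rewrite -(Gauss_dvdr _ co_ef) -(dvdn_pmul2r g_gt0) -dE.
  by rewrite mulnAC -aE.
by exists i, j; split => //; rewrite dE gE eE mulnC.
Qed.

(** * From a set of divisors to a choice of coefficients *)

(** Separates the two end divisors from the list [D] of those that receive a coefficient. *)
Lemma divisors_inner (n : nat) : 1 < n -> exists D, divisors n = 1 :: rcons D n.
Proof.
move=> n_gt1; have n_gt0 := ltnW n_gt1.
have div_le d : d \in divisors n -> 0 < d <= n.
  rewrite -(dvdn_divisors _ n_gt0) => d_n.
  by apply/andP; split; [apply: dvdn_gt0 n_gt0 d_n | apply: dvdn_leq].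
have := sorted_divisors n; have := divisors_id n_gt0; have := divisor1 n.
case: (divisors n) div_le => // x s div_le x1 xn x_s.
have x_eq : x = 1.
  apply/eqP; rewrite eqn_leq; have /div_le/andP[-> _] := mem_head x s.
  have := order_path_min leq_trans x_s; move: x1; rewrite inE.
  case/predU1P=> [<- //|s1].
  by move/allP/(_ _ s1) ->.
subst x; case/lastP: s div_le x1 xn x_s => [|s y] div_le _.
  by rewrite inE => /eqP n1; rewrite n1 in n_gt1.
rewrite inE gtn_eqF //= => yn y_s; exists s; congr (_ :: rcons _ _).
apply/eqP; rewrite eqn_leq.
have /div_le/andP[_ ->] : y \in 1 :: rcons s y.
  by rewrite inE mem_rcons mem_head orbT.
move: yn; rewrite mem_rcons inE /= => /predU1P[-> //|ns].
have := path_sorted y_s; rewrite (sorted_pairwise leq_trans) pairwise_rcons.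
by case/andP => /allP/(_ _ ns).
Qed.

Lemma S_perfect_of_subset (m : int) (n : nat) (B : seq nat) :
  1 < n -> uniq B -> {in B, forall d, [/\ d %| n, 1 < d & d < n]} ->
  ((m + 1) * (sumn B)%:Z + 2 = (sumn (divisors n))%:Z)%R ->
  S_perfect [set (-1)%R; m] n.
Proof.
move=> n_gt1 B_uniq B_div B_sum; split => //.
pose c d := (if d \in B then m else -1)%R.
exists (fun j => c (nth 0 (divisors n) j)); split.
  by move=> j _; rewrite /c; case: ifP => _; [right | left].
have [D divE] := divisors_inner _ n_gt1.
have BD : perm_eq [seq d <- D | d \in B] B.
  have := divisors_uniq n; rewrite divE /= rcons_uniq => /and3P[_ _ D_uniq].
  apply: uniq_perm; rewrite ?filter_uniq // => d; rewrite mem_filter.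
  case: (boolP (d \in B)) => //= dB; have [d_n d_gt1 d_lt] := B_div _ dB.
  move: d_n; rewrite dvdn_divisors ?(ltnW n_gt1) // divE inE mem_rcons inE.
  by rewrite (gtn_eqF d_gt1) (ltn_eqF d_lt).
have sumD : (\sum_(d <- D) c d * d%:Z = (m + 1) * (sumn B)%:Z - (sumn D)%:Z)%R.
  rewrite -(perm_sumn BD) sumnE big_filter !sumnE.
  rewrite -!natz !natr_sum mulr_sumr (big_mkcond (mem B)) -sumrB.
  by apply: eq_bigr => d _; rewrite /c /= !natz; case: ifP => _; ring.
move: B_sum; rewrite divE /= sumn_rcons /ndiv_inner divE /= size_rcons subn2 /=.
rewrite big_add1 /=.
(* After the index shift past the divisor 1, the range stops just before the final entry [n]. *)
have -> : (\sum_(0 <= i < size D)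
    c (nth 0 (rcons D n) i) * (nth 0 (rcons D n) i)%:Z =
    \sum_(d <- D) c d * d%:Z)%R.
  rewrite [RHS](big_nth 0); apply: eq_big_nat => i /andP[_ lti].
  by rewrite nth_rcons lti.
rewrite sumD; move: ((m + 1) * _)%R => x; lia.
Qed.

(** Here [M] is m + 1, and the equation for [s] says sigma(n) = 2Ms + 2. *)
Lemma S_perfect_pow2_mul (M p k b s : nat) :
  1 < M -> prime p -> odd p -> 0 < k -> 3 * p.+1 <= 2 ^ b.+2 ->
  M * s.*2 + 2 = (2 ^ b.+2 - 1) * \sum_(j < k.+1) p ^ j ->
  S_perfect [set (-1)%R; (M%:Z - 1)%R] (2 ^ b.+1 * p ^ k).
Proof.
move=> M_gt1 p_prime p_odd k_gt0 p_le sE; have p_gt0 := prime_gt0 p_prime.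
have p_le2 : 0 < p <= 2 ^ b.+1.
  by rewrite p_gt0 -(leq_pmul2l (ltn0Sn 1)) -expnS; lia.
(* The divisors of n / 2 other than n / 2 itself. *)
pose L := grid b.+1 p k ++ dyadic b (p ^ k).
have gridE : grid b.+1 p k.+1 = rcons L (2 ^ b * p ^ k).
  rewrite gridS rcons_cat /dyadic -(addn1 b) iotaD map_cat /= add0n.
  by rewrite addn1 cats1.
have L_complete : subset_sums_full L.
  apply: subset_sums_dyadic; first exact: subset_sums_grid.
  exact: expn_le_sumn_grid.
(* As M >= 2, 4s <= sigma(n) - 2. With H = 1 + ... + p^(k-1) and p^k <= (p - 1)H + 1, it suffices
   that 3pH + 1 <= 2^(b+2) H, which follows from 3(p + 1) <= 2^(b+2) and H >= 1. *)
have s_le : s <= sumn L.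
  rewrite sumn_cat sumn_grid sumn_dyadic.
  have := expn_le_geom_sum _ k p_gt0; move: sE; rewrite big_ord_recr /=.
  have : 0 < \sum_(j < k) p ^ j.
    by rewrite -(prednK k_gt0) big_ord_recl.
  move: (\sum_(j < k) p ^ j) (p ^ k) p_le => H P; rewrite !expnS.
  have : 0 < 2 ^ b by rewrite expn_gt0.
  move: (2 ^ b) => A A_gt0 p_le H_gt0 sE P_le.
  have : 2 * s.*2 <= M * s.*2 by rewrite leq_mul2r M_gt1 orbT.
  nia.
have [B BL B_sum] := L_complete _ s_le.
have [L_uniq L_last] : uniq L /\ 2 ^ b * p ^ k \notin L.
  apply/andP; rewrite andbC -rcons_uniq -gridE.
  by rewrite (perm_uniq (perm_grid_divisors _ k p_prime p_odd)) divisors_uniq.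
have n_gt0 : 0 < 2 ^ b * p ^ k by rewrite muln_gt0 !expn_gt0 p_gt0.
have n_gt1 : 1 < 2 ^ b.+1 * p ^ k by rewrite expnS -mulnA; lia.
apply: (S_perfect_of_subset _ _ [seq 2 * d | d <- B]) => //.
- rewrite map_inj_uniq ?(subseq_uniq BL) // => x y; lia.
- move=> _ /mapP[d dB ->]; have dL := mem_subseq BL dB.
  have d_neq : d != 2 ^ b * p ^ k by apply: contraNneq L_last => <-.
  have dvd_d : d %| 2 ^ b * p ^ k.
    rewrite dvdn_divisors // -(perm_mem (perm_grid_divisors _ _ p_prime p_odd)).
    by rewrite gridE mem_rcons inE dL orbT.
  have d_gt0 := dvdn_gt0 n_gt0 dvd_d.
  rewrite expnS -mulnA dvdn_pmul2l //; split => //; first by lia.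
  by rewrite ltn_pmul2l // ltn_neqAle d_neq dvdn_leq.
- rewrite -(perm_sumn (perm_grid_divisors _ _ p_prime p_odd)) sumn_grid -sE.
  have -> : sumn [seq 2 * d | d <- B] = s.*2.
    by rewrite -B_sum; elim: (B) => //= d B' ->; lia.
  lia.
Qed.

(** * Choice of the exponents modulo 2M *)

Lemma modn_exp_sum (p N k : nat) : p = 1 %[mod N] ->
  \sum_(j < k) p ^ j = k %[mod N].
Proof.
move=> p1; rewrite -modn_summ.
under eq_bigr => j _ do rewrite -modnXm p1 modnXm exp1n.
by rewrite modn_summ sum1_card card_ord.
Qed.

(** If totient(M') divides a, with M' the odd part of M, then 2^(a+1) = 2 mod M' by Euler, so the
    odd number 2^(a+1) - 1 is 1 mod M'. *)
Lemma coprime_pow2_sub1 (M j : nat) : 0 < M ->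
  exists2 a, j <= a & coprime (2 ^ a.+1 - 1) (2 * M).
Proof.
move=> M_gt0; have [M' M'_odd ME] := pfactor_coprime (isT : prime 2) M_gt0.
have M'_gt0 : 0 < M' by move: M_gt0; rewrite ME muln_gt0 => /andP[].
exists (totient M' * j); first by rewrite leq_pmull ?totient_gt0.
have u_odd : odd (2 ^ (totient M' * j).+1 - 1).
  by rewrite oddB ?expn_gt0 // oddX.
rewrite ME mulnCA -expnS coprimeMr coprimeXr ?coprimen2 // andbT.
rewrite -coprime_modl.
suff -> : 2 ^ (totient M' * j).+1 - 1 = 1 %[mod M'].
  by rewrite coprime_modl coprime1n.
have E : 2 ^ (totient M' * j).+1 = 2 %[mod M'].
  rewrite expnS expnM -modnMmr -modnXm Euler_exp_totient //.
  by rewrite modnXm exp1n modnMmr.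
apply/eqP; rewrite -(eqn_modDr 1) subnK ?expn_gt0 //; exact/eqP.
Qed.

Lemma S_perfect_unbounded (M j : nat) : 1 < M ->
  exists2 n, j < n & S_perfect [set (-1)%R; (M%:Z - 1)%R] n.
Proof.
move=> M_gt1; have M2_gt1 : 1 < 2 * M by lia.
have M2_gt0 := ltnW M2_gt1.
have [p p_prime p1] := exists_prime_modn1 M2_gt0.
have p_odd : odd p.
  have : p = 1 %[mod 2].
    by rewrite -(modn_dvdm p (dvdn_mulr M (dvdnn 2))) p1 modn_dvdm ?dvdn_mulr.
  by rewrite modn2; case: (odd p).
(* This bound makes [2 ^ b.+1] exceed [j] and [2 ^ b.+2] at least [3 * p.+1]. *)
have [[|b]] := coprime_pow2_sub1 M (3 * p + j).+1 (ltnW M_gt1) => // le_b co_u.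
have b_lt : b.+1 < 2 ^ b.+1 by apply: ltn_expl.
have j_lt : j < 2 ^ b.+1 by lia.
have p_le : 3 * p.+1 <= 2 ^ b.+2 by rewrite expnS; lia.
have u_gt1 : 1 < 2 ^ b.+2 - 1 by have := ltn_expl b.+2 (isT : 1 < 2); lia.
set u := 2 ^ b.+2 - 1 in co_u u_gt1.
have [c uc] : exists c, u * c = 1 %[mod 2 * M].
  exists (u ^ (totient (2 * M)).-1).
  by rewrite -expnS prednK ?totient_gt0 // Euler_exp_totient.
(* [2 * c] makes u(k + 1) equal 2 mod 2M; the added [2 * M] ensures [k > 0]. *)
have [k k_gt0 kE] : exists2 k, 0 < k & k.+1 = 2 * c + 2 * M.
  exists (2 * c + 2 * M).-1; first by rewrite -subn1 subn_gt0 ltn_addl.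
  by rewrite prednK // addn_gt0 M2_gt0 orbT.
have G2 : u * \sum_(i < k.+1) p ^ i = 2 %[mod 2 * M].
  rewrite -modnMmr modn_exp_sum // modnMmr.
  by rewrite kE mulnDr -modnDmr modnMl addn0 mulnCA -modnMmr uc modnMmr.
have G_ge2 : 2 <= u * \sum_(i < k.+1) p ^ i.
  by rewrite (leq_trans u_gt1) // leq_pmulr // big_ord_recl.
have /dvdnP[s sE] : 2 * M %| u * \sum_(i < k.+1) p ^ i - 2.
  by rewrite -eqn_mod_dvd //; apply/eqP.
exists (2 ^ b.+1 * p ^ k).
  by rewrite (leq_trans j_lt) // leq_pmulr // expn_gt0 prime_gt0.
apply: (S_perfect_pow2_mul _ _ _ _ s) => //.
rewrite -/u -(subnK G_ge2) sE; congr (_ + 2).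
by rewrite -muln2 mulnC -mulnA mulnC.
Qed.

Local Open Scope classical_set_scope.
Local Open Scope ring_scope.

Theorem corollary11 (m : int) (hm : 1 <= m) :
  infinite_set [set n : nat | S_perfect [set -1; m] n].
Proof.
case/finite_seqP => ns nsE.
(* [sumn ns] bounds every entry of [ns], so a larger perfect number cannot be listed there. *)
have [|n lt_n] := S_perfect_unbounded `|(m + 1)%R|%N (sumn ns); first by lia.
have -> : Posz `|(m + 1)%R|%N - 1 = m by lia.
move=> n_perfect; have n_ns : n \in ns by have : [set` ns] n by rewrite -nsE.
by move: lt_n; rewrite sumnE (big_rem n) //=; lia.
Qed.
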